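(* Let $A$ be a clustering of $\{1,\dots,n\}$ with $1<k_A<n$, let $s$ be a cluster-size specification of $n$ elements, and let $B\sim\mathcal C(s)$. Then $$\mathbf E[\mathrm{CD}(A,B)]-\tfrac12=-\frac1\pi\sum_{k=1}^\infty\frac{(2k)!}{2^{2k}(k!)^2}\,\frac{\mathbf E[\mathrm{CC}(A,B)^{2k+1}]}{2k+1}.$$
   Context: A clustering of $\{1,\dots,n\}$ is a partition $A=\{A_1,\dots,A_{k_A}\}$ into nonempty clusters. Let $N=\binom n2$. For a clustering $A$, let $\vec A\in\{0,1\}^N$ be indexed by unordered pairs of distinct elements, with entry $1$ iff the pair lies in one cluster of $A$; let $m_A$ be the number of such pairs and $\mathbf 1$ the all-ones vector. Define $\vec u(A)=\frac1{\sqrt N}\mathbf 1$ if $k_A=1$, $\vec u(A)=(\vec A-\frac{m_A}N\mathbf 1)/\|\vec A-\frac{m_A}N\mathbf 1\|$ if $1<k_A<n$, $\vec u(A)=-\frac1{\sqrt N}\mathbf 1$ if $k_A=n$. Then $\mathrm{CC}(A,B)=\langle\vec u(A),\vec u(B)\rangle$ (the Pearson correlation of $\vec A,\vec B$ when both clusterings are nontrivial) and $\mathrm{CD}(A,B)=\frac1\pi\arccos\mathrm{CC}(A,B)$. For a multiset $s$ of positive integers summing to $n$, $\mathcal C(s)$ is the uniform distribution over clusterings with cluster sizes $s$. *)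

(* Defs.v *)
From Stdlib Require Import Reals.
From mathcomp Require Import all_boot.

Set Implicit Arguments.
Unset Strict Implicit.
Unset Printing Implicit Defensive.

Local Open Scope R_scope.

(* A clustering of {0,...,n-1} (relabelling of {1,...,n}) is a set of blocks
   P : {set {set 'I_n}} with [partition P [set: 'I_n]] (nonempty, disjoint,
   covering blocks); k_P = #|P|. *)
Definition clustering (n : nat) (P : {set {set 'I_n}}) : bool :=
  partition P [set: 'I_n].

Definition pairs_sum (n : nat) (F : 'I_n -> 'I_n -> R) : R :=
  \big[Rplus/0]_(p : 'I_n * 'I_n | ltn p.1 p.2) F p.1 p.2.

Definition Npairs (n : nat) : R := INR 'C(n, 2).

Definition indic (n : nat) (P : {set {set 'I_n}}) (i j : 'I_n) : R :=
  if [exists B in P, (i \in B) && (j \in B)] then 1 else 0.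

Definition mA (n : nat) (P : {set {set 'I_n}}) : R := pairs_sum (indic P).

Definition centered (n : nat) (P : {set {set 'I_n}}) (i j : 'I_n) : R :=
  indic P i j - mA P / Npairs n.

Definition cnorm (n : nat) (P : {set {set 'I_n}}) : R :=
  sqrt (pairs_sum (fun i j => (centered P i j) ^ 2)).

Definition uvec (n : nat) (P : {set {set 'I_n}}) (i j : 'I_n) : R :=
  if #|P| == 1%N then / sqrt (Npairs n)
  else if #|P| == n then - / sqrt (Npairs n)
  else centered P i j / cnorm P.

Definition CC (n : nat) (A B : {set {set 'I_n}}) : R :=
  pairs_sum (fun i j => uvec A i j * uvec B i j).

Definition CD (n : nat) (A B : {set {set 'I_n}}) : R :=
  / PI * acos (CC A B).

(* cluster sizes of P as a sequence (a multiset up to perm_eq) *)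
Definition sizes (n : nat) (P : {set {set 'I_n}}) : seq nat :=
  map (fun B : {set 'I_n} => #|B|) (enum P).

Definition size_spec (n : nat) (s : seq nat) : Prop :=
  all (fun x => ltn 0%nat x) s /\ sumn s = n.

Definition clusterings_with (n : nat) (s : seq nat) : {set {set {set 'I_n}}} :=
  [set P : {set {set 'I_n}} | clustering P && perm_eq (sizes P) s].

Definition Expect_C (n : nat) (s : seq nat) (f : {set {set 'I_n}} -> R) : R :=
  (\big[Rplus/0]_(P in clusterings_with n s) f P) / INR #|clusterings_with n s|.

Definition acoef (k : nat) : R :=
  INR (Factorial.fact (2 * k)%nat) / (2 ^ (2 * k)%nat * (INR (Factorial.fact k)) ^ 2).

Arguments Expect_C : clear implicits.
Arguments clusterings_with : clear implicits.

(* Main.v *)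
(** For [-1 <= x <= 1], [acos x = PI / 2 - asin x], and the Taylor series of
    [asin] has coefficients [acoef k / (2 k + 1)].  It converges to [asin] on
    the whole closed interval: inside because [acoef] generates
    [1 / sqrt (1 - x)], at the endpoints by monotone convergence.  Taking
    expectations term by term (a finite average) gives the claimed expansion
    plus the term [k = 0], a multiple of [E (CC A B)].  That term vanishes:
    relabelling the points preserves the distribution of [B] and acts
    transitively on pairs, so the average of [uvec B] is a constant vector,
    while the entries of [uvec A] sum to 0. *)
Require Import Defs.
From Stdlib Require Import Reals Lra.
From mathcomp Require Import all_boot perm ssralg Rstruct.
From Coquelicot Require Import Coquelicot.

Set Implicit Arguments.
Unset Strict Implicit.
Unset Printing Implicit Defensive.

Local Open Scope R_scope.

(** * Series and power series *)

Lemma is_series_le (u v : nat -> R) (l m : R) :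
  (forall k, u k <= v k) -> is_series u l -> is_series v m -> l <= m.
Proof.
move=> uv ul vm; apply: (is_lim_seq_le (sum_n u) (sum_n v) l m _ ul vm) => N.
exact: sum_n_m_le.
Qed.

Lemma sum_n_le_is_series (u : nat -> R) (l : R) N :
  (forall k, 0 <= u k) -> is_series u l -> sum_n u N <= l.
Proof.
move=> u_ge0 ul; apply: (is_lim_seq_incr_compare (sum_n u) l ul) => n.
by rewrite sum_Sn /plus /=; have := u_ge0 n.+1; lra.
Qed.

Lemma filterlim_sum_n (T : Type) (F : (T -> Prop) -> Prop) (u : nat -> T -> R)
    (l : nat -> R) N : Filter F ->
  (forall k, filterlim (u k) F (locally (l k))) ->
  filterlim (fun x => sum_n (u^~ x) N) F (locally (sum_n l N)).
Proof.
move=> FF ul; elim: N => [|N IH].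
  by rewrite sum_O; apply: filterlim_ext (ul 0%N) => x; rewrite sum_O.
rewrite sum_Sn.
apply: (filterlim_ext (fun x => plus (sum_n (u^~ x) N) (u N.+1 x))) => [x|].
  by rewrite sum_Sn.
exact: filterlim_comp_2 IH (ul N.+1) (filterlim_plus _ _).
Qed.

Lemma at_left_itv (a b : R) : a < b -> at_left b (fun x => a <= x < b).
Proof.
move=> ab; have ba : 0 < b - a by lra.
exists (mkposreal _ ba) => x /= /Rabs_lt_between xb x_lt_b.
by move: xb; rewrite /minus /plus /opp /=; lra.
Qed.

Lemma is_series_at_left (u : nat -> R -> R) (f : R -> R) (a b : R) :
  a < b ->
  (forall k x, a <= x <= b -> 0 <= u k x <= u k b) ->
  (forall k, filterlim (u k) (at_left b) (locally (u k b))) ->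
  filterlim f (at_left b) (locally (f b)) ->
  (forall x, a <= x < b -> is_series (u^~ x) (f x)) ->
  is_series (u^~ b) (f b).
Proof.
move=> ab u_le u_lim f_lim uf; have ab_left := at_left_itv ab.
have ub_ge0 k : 0 <= u k b by have [] := u_le k b; lra.
have partial_sum_le N : sum_n (u^~ b) N <= f b.
  apply: (filterlim_le (F := at_left b) _ _ (sum_n (u^~ b) N) (f b) _
    (filterlim_sum_n _ u_lim) f_lim).
  apply: filter_imp ab_left => x xab; apply: sum_n_le_is_series (uf x xab) => k.
  by have [] := u_le k x; lra.
have partial_sum_incr N : sum_n (u^~ b) N <= sum_n (u^~ b) N.+1.
  by rewrite sum_Sn /plus /=; have := ub_ge0 N.+1; lra.
have [l ul] := ex_finite_lim_seq_incr _ _ partial_sum_incr partial_sum_le.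
suff -> : f b = l by [].
apply: Rle_antisym; last first.
  exact: (is_lim_seq_le _ _ _ _ partial_sum_le ul (is_lim_seq_const _)).
apply: (filterlim_le (F := at_left b) f (fun=> l) (f b) l _ f_lim
  (filterlim_const l)).
apply: filter_imp ab_left => x xab; apply: is_series_le (uf x xab) ul => k.
by have [] := u_le k x; lra.
Qed.

Lemma filterlim_asin_at_left1 : filterlim asin (at_left 1) (locally (asin 1)).
Proof.
apply/filterlim_locally => eps.
have pi_gt0 := PI_RGT_0; have eps_gt0 := cond_pos eps.
pose d := Rmin (eps / 2) (PI / 2).
have d_gt0 : 0 < d by apply: Rmin_glb_lt; lra.
have d_eps : d < eps by apply: Rle_lt_trans (Rmin_l _ _) _; lra.
have d_pi : d <= PI / 2 by apply: Rmin_r.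
have sin_lt1 : sin (PI / 2 - d) < 1.
  by rewrite -sin_PI2; apply: sin_increasing_1; lra.
have sin_ge0 : 0 <= sin (PI / 2 - d) by apply: sin_ge_0; lra.
apply: filter_imp (at_left_itv sin_lt1) => x [sin_le_x x_lt1].
have [asin_lb asin_ub] := asin_bound x.
have asin_ge : PI / 2 - d <= asin x.
  apply: Rnot_lt_le => asin_lt.
  suff : sin (asin x) < sin (PI / 2 - d) by rewrite sin_asin; lra.
  by apply: sin_increasing_1; lra.
by rewrite asin_1; apply: Rabs_def1; rewrite /minus /plus /opp /=; lra.
Qed.

Lemma is_derive_asin (x : R) :
  -1 < x < 1 -> is_derive asin x (/ sqrt (1 - x ^ 2)).
Proof.
move=> x1; apply/is_derive_Reals.
apply/(derive_pt_eq_1 asin x _ (derivable_pt_asin x x1)).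
by rewrite derive_pt_asin Rsqr_pow2; apply: Rmult_1_l.
Qed.

Lemma is_derive_zero_eq (f : R -> R) (r x : R) :
  (forall t, Rabs t < r -> is_derive f t 0) -> Rabs x < r -> f x = f 0.
Proof.
move=> f'0 /Rabs_lt_between xr.
have [x_lt0 | [-> | x_gt0]] := Rtotal_order x 0; first 2 last.
- apply/esym/(eq_is_derive (V := R_NormedModule)) => // t t0x.
  by apply: f'0; apply/Rabs_lt_between; lra.
- apply: (eq_is_derive (V := R_NormedModule)) => // t t0x.
  by apply: f'0; apply/Rabs_lt_between; lra.
by [].
Qed.

Lemma PSeries_affine_mul (a : nat -> R) (c d x : R) :
  Rbar_lt (Rabs x) (CV_radius a) ->
  PSeries (fun n => (c * INR n + d) * a n) x =
  c * (x * PSeries (PS_derive a) x) + d * PSeries a x.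
Proof.
move=> ax; have ex_derive : ex_pseries (PS_derive a) x.
  by apply: CV_radius_inside; rewrite CV_radius_derive.
have ex_scal (e : R) (b : nat -> R) :
    ex_pseries b x -> ex_pseries (PS_scal e b) x.
  by apply: ex_pseries_scal; apply: Rmult_comm.
rewrite -PSeries_incr_1 -!PSeries_scal -PSeries_plus.
- apply: PSeries_ext => -[|n]; rewrite /PS_plus /PS_scal /PS_incr_1.
    by rewrite /plus /scal /zero /= /mult /=; ring.
  by rewrite /plus /scal /= /mult /PS_derive -/(INR n.+1) /=; ring.
- exact/ex_scal/ex_pseries_incr_1.
- exact/ex_scal/CV_radius_inside.
Qed.

Lemma Rabs_lt_CV_radius_bounded (a : nat -> R) (M x : R) :
  (forall n, Rabs (a n) <= M) -> Rabs x < 1 -> Rbar_lt (Rabs x) (CV_radius a).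
Proof.
move=> aM x1; apply: (@Rbar_lt_le_trans _ 1) => //.
by apply: (proj1 (CV_radius_bounded a)); exists M => n; rewrite pow1 Rmult_1_r.
Qed.

(** * The arcsine series *)

Lemma INR_odd k : INR (2 * k + 1)%N = 2 * INR k + 1.
Proof. by rewrite -plusE -multE plus_INR mult_INR. Qed.

Lemma pow_odd (x : R) (k : nat) : x ^ (2 * k + 1)%N = x * (x ^ 2) ^ k.
Proof. by rewrite -pow_mult multE addn1. Qed.

Lemma acoef0 : acoef 0 = 1.
Proof. by rewrite /acoef muln0 /=; field. Qed.

Lemma acoefS k : acoef k.+1 * (2 * INR k.+1) = acoef k * (2 * INR k + 1).
Proof.
have factS m : INR (Factorial.fact m.+1) = INR m.+1 * INR (Factorial.fact m).
  exact: mult_INR.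
rewrite /acoef mulnS !addSn add0n !factS !S_INR -multE mult_INR multE /=.
field; split; first exact: INR_fact_neq_0.
by have := pos_INR k; split; [apply: pow_nonzero|]; lra.
Qed.

Lemma acoef_gt0 k : 0 < acoef k.
Proof.
apply: Rdiv_lt_0_compat; first exact: INR_fact_lt_0.
by apply: Rmult_lt_0_compat; apply: pow_lt; [lra | apply: INR_fact_lt_0].
Qed.

Lemma acoef_le1 k : acoef k <= 1.
Proof.
elim: k => [|k IH]; first by rewrite acoef0; lra.
have := acoefS k; have := acoef_gt0 k; have := pos_INR k; rewrite S_INR.
by nra.
Qed.

Lemma Rabs_lt_CV_radius_acoef x :
  Rabs x < 1 -> Rbar_lt (Rabs x) (CV_radius acoef).
Proof.
apply: (@Rabs_lt_CV_radius_bounded _ 1) => k.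
have := acoef_gt0 k; have := acoef_le1 k.
by move=> *; rewrite Rabs_pos_eq; lra.
Qed.

(* The recurrence [acoefS] is the differential equation [2 (1 - x) g' = g],
   which makes [g x * sqrt (1 - x)] constant. *)
Lemma PSeries_acoef x : Rabs x < 1 -> PSeries acoef x = / sqrt (1 - x).
Proof.
have sqrt_gt0 t : Rabs t < 1 -> 0 < sqrt (1 - t).
  by move=> /Rabs_lt_between t1; apply: sqrt_lt_R0; lra.
move=> x1; have sqrt_x := sqrt_gt0 x x1.
apply: (Rmult_eq_reg_r (sqrt (1 - x))); last by lra.
rewrite Rinv_l; last by lra.
rewrite (is_derive_zero_eq (f := fun t => PSeries acoef t * sqrt (1 - t)) _ x1).
  by rewrite Rminus_0_r sqrt_1 PSeries_0 acoef0; lra.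
move=> t t1; have sqrt_t := sqrt_gt0 t t1.
have t_in := Rabs_lt_CV_radius_acoef t1.
have sqr_sqrt : sqrt (1 - t) * sqrt (1 - t) = 1 - t.
  by move: t1 => /Rabs_lt_between t1; apply: sqrt_sqrt; lra.
have ode : 2 * PSeries (PS_derive acoef) t =
    2 * (t * PSeries (PS_derive acoef) t) + 1 * PSeries acoef t.
  rewrite -PSeries_affine_mul // -PSeries_scal; apply: PSeries_ext => n.
  rewrite [RHS]Rmult_comm -acoefS /PS_scal /PS_derive /scal /= /mult /=; ring.
have g' := is_derive_PSeries acoef t t_in.
set dg := PSeries (PS_derive acoef) t in ode g'.
have sqrt' : is_derive (fun t => sqrt (1 - t)) t (- / (2 * sqrt (1 - t))).
  by auto_derive; rewrite -/(Rminus 1 t); [nra | field; lra].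
evar_last; first by apply: is_derive_mult g' sqrt' _ => *; apply: Rmult_comm.
rewrite /plus /mult /=; apply: (Rmult_eq_reg_r (2 * sqrt (1 - t))); last by lra.
transitivity (2 * dg * (sqrt (1 - t) * sqrt (1 - t)) - PSeries acoef t).
  by field; lra.
by rewrite sqr_sqrt; lra.
Qed.

Definition asin_coef (k : nat) : R := acoef k / INR (2 * k + 1)%N.

Lemma asin_coef_mul k x : asin_coef k * x = acoef k * x / INR (2 * k + 1)%N.
Proof. by rewrite /asin_coef /Rdiv; ring. Qed.

Lemma asin_coef_gt0 k : 0 < asin_coef k.
Proof.
apply: Rdiv_lt_0_compat; first exact: acoef_gt0.
by rewrite INR_odd; have := pos_INR k; lra.
Qed.

Lemma asin_coef_le1 k : asin_coef k <= 1.
Proof.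
have k_ge0 := pos_INR k; apply: Rle_trans (acoef_le1 k).
rewrite /asin_coef INR_odd; apply/Rle_div_l; first by lra.
by have := acoef_gt0 k; nra.
Qed.

Lemma Rabs_lt_CV_radius_asin_coef x :
  Rabs x < 1 -> Rbar_lt (Rabs x) (CV_radius asin_coef).
Proof.
apply: (@Rabs_lt_CV_radius_bounded _ 1) => k.
have := asin_coef_gt0 k; have := asin_coef_le1 k.
by move=> *; rewrite Rabs_pos_eq; lra.
Qed.

Lemma Rabs_sqr_lt1 x : Rabs x < 1 -> Rabs (x ^ 2) < 1.
Proof. by move=> x1; rewrite -RPow_abs; have := Rabs_pos x; nra. Qed.

Lemma PSeries_asin_coef x :
  Rabs x < 1 -> x * PSeries asin_coef (x ^ 2) = asin x.
Proof.
move=> x1; pose gap t := t * PSeries asin_coef (t ^ 2) - asin t.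
suff : gap x = gap 0 by rewrite /gap asin_0; lra.
apply: is_derive_zero_eq x1 => t t1; have tt1 := Rabs_sqr_lt1 t1.
have t_in := Rabs_lt_CV_radius_asin_coef tt1.
have p' : is_derive (fun t => PSeries asin_coef (t ^ 2)) t
    (2 * t * PSeries (PS_derive asin_coef) (t ^ 2)).
  apply: (is_derive_comp (V := R_NormedModule) (PSeries asin_coef)).
    exact: is_derive_PSeries.
  by auto_derive => //; ring.
have asin' : is_derive asin t (PSeries acoef (t ^ 2)).
  by rewrite PSeries_acoef //; apply/is_derive_asin/Rabs_lt_between.
evar_last.
  apply: (is_derive_minus (V := R_NormedModule)) _ asin'.
  by apply: is_derive_mult (is_derive_id t) p' _ => *; apply: Rmult_comm.
have -> : PSeries acoef (t ^ 2) =
    PSeries (fun n => (2 * INR n + 1) * asin_coef n) (t ^ 2).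
  apply: PSeries_ext => n; rewrite /asin_coef INR_odd; field.
  by have := pos_INR n; lra.
rewrite PSeries_affine_mul // /minus /plus /opp /mult /one /=; ring.
Qed.

Lemma is_series_asin_interior x : Rabs x < 1 ->
  is_series (fun k => asin_coef k * x ^ (2 * k + 1)%N) (asin x).
Proof.
move=> x1; rewrite -PSeries_asin_coef //.
have /is_pseries_R series_sqr :
    is_pseries asin_coef (x ^ 2) (PSeries asin_coef (x ^ 2)).
  apply/PSeries_correct/CV_radius_inside/Rabs_lt_CV_radius_asin_coef.
  exact: Rabs_sqr_lt1.
apply: is_series_ext (is_series_scal_l x _ _ series_sqr) => k.
by rewrite pow_odd /scal /= /mult /=; ring.
Qed.

Lemma is_series_asin1 :
  is_series (fun k => asin_coef k * 1 ^ (2 * k + 1)%N) (asin 1).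
Proof.
apply: (@is_series_at_left (fun k x => asin_coef k * x ^ (2 * k + 1)%N) asin 0).
- by lra.
- move=> k x x01; have coef_gt0 := asin_coef_gt0 k.
  have pow_ge0 : 0 <= x ^ (2 * k + 1)%N by apply: pow_le; lra.
  have : x ^ (2 * k + 1)%N <= 1 ^ (2 * k + 1)%N by apply: pow_incr; lra.
  by split; nra.
- move=> k.
  have cont : continuous (fun x => asin_coef k * x ^ (2 * k + 1)%N) 1.
    by apply: (ex_derive_continuous (V := R_NormedModule)); auto_derive.
  by apply: filterlim_filter_le_1 cont; apply: filter_le_within.
- exact: filterlim_asin_at_left1.
- by move=> x x01; apply: is_series_asin_interior; rewrite Rabs_pos_eq; lra.
Qed.

Lemma is_series_asin x : -1 <= x <= 1 ->
  is_series (fun k => asin_coef k * x ^ (2 * k + 1)%N) (asin x).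
Proof.
move=> x1; case: (Rlt_dec (Rabs x) 1) => [|/Rnot_lt_le].
  exact: is_series_asin_interior.
rewrite /Rabs; case: Rcase_abs => _ x_end; last first.
  have -> : x = 1 by lra.
  exact: is_series_asin1.
have -> : x = - (1) by lra.
rewrite asin_opp; apply: is_series_ext (is_series_opp _ _ is_series_asin1) => k.
by rewrite !pow_odd -[(- (1)) ^ 2]Rsqr_pow2 -Rsqr_neg Rsqr_pow2 /opp /=; ring.
Qed.

(** * Finite sums and sums over pairs *)

Lemma Rsum_const (I : finType) (A : {pred I}) (c : R) :
  \big[Rplus/0]_(i in A) c = INR #|A| * c.
Proof.
rewrite -[LHS]/(\sum_(i in A) (c : R))%R GRing.sumr_const.
by rewrite -GRing.mulr_natl INRE.
Qed.

Lemma Rsum_sqr_ge0 (I : Type) (r : seq I) (P : pred I) (F : I -> R) :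
  0 <= \big[Rplus/0]_(i <- r | P i) F i ^ 2.
Proof.
elim/big_rec: _ => [|i x _ x_ge0]; first exact: Rle_refl.
by have := pow2_ge_0 (F i); lra.
Qed.

Lemma Rsum_CauchySchwarz (I : Type) (r : seq I) (P : pred I) (F G : I -> R) :
  (\big[Rplus/0]_(i <- r | P i) (F i * G i)) ^ 2 <=
  \big[Rplus/0]_(i <- r | P i) F i ^ 2 * \big[Rplus/0]_(i <- r | P i) G i ^ 2.
Proof.
set c := \big[_/_]_(i <- r | P i) (F i * G i).
set a := \big[_/_]_(i <- r | P i) F i ^ 2.
set b := \big[_/_]_(i <- r | P i) G i ^ 2.
have quadratic_ge0 x y : 0 <= x ^ 2 * a + 2 * x * y * c + y ^ 2 * b.
  have -> : x ^ 2 * a + 2 * x * y * c + y ^ 2 * b =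
      \big[Rplus/0]_(i <- r | P i) (x * F i + y * G i) ^ 2.
    by rewrite /a /b /c !big_distrr -!big_split; apply: eq_bigr => i _ /=; ring.
  exact: Rsum_sqr_ge0.
have a_ge0 : 0 <= a by apply: Rsum_sqr_ge0.
have b_ge0 : 0 <= b by apply: Rsum_sqr_ge0.
case: (Rle_lt_or_eq_dec _ _ a_ge0) => [a_gt0 | a0].
  by have := quadratic_ge0 (- c) a; nra.
case: (Rle_lt_or_eq_dec _ _ b_ge0) => [b_gt0 | b0].
  by have := quadratic_ge0 b (- c); nra.
have := quadratic_ge0 1 1; have := quadratic_ge0 1 (- 1).
by rewrite -a0 -b0; nra.
Qed.

Lemma is_series_Rsum (I : Type) (r : seq I) (P : pred I)
    (u : I -> nat -> R) (l : I -> R) :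
  (forall i, P i -> is_series (u i) (l i)) ->
  is_series (fun k => \big[Rplus/0]_(i <- r | P i) u i k)
            (\big[Rplus/0]_(i <- r | P i) l i).
Proof.
move=> ul; elim: r => [|i r IH].
  rewrite big_nil; apply: (is_series_ext (fun=> 0)) => [k|].
    by rewrite big_nil.
  apply: (filterlim_ext (fun=> 0)); last exact: filterlim_const.
  by move=> N; rewrite sum_n_const Rmult_0_r.
rewrite big_cons; case: ifP => Pi.
  apply: is_series_ext (is_series_plus _ _ _ _ (ul i Pi) IH) => k.
  by rewrite big_cons Pi.
by apply: is_series_ext IH => k; rewrite big_cons Pi.
Qed.

Lemma card_ordered_pairs n :
  #|[pred p : 'I_n * 'I_n | ltn p.1 p.2]| = 'C(n, 2).
Proof.
rewrite -sum1_card -bin2_sum big_mkord.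
rewrite -(pair_big_dep xpredT (fun i j : 'I_n => ltn i j) (fun _ _ => 1%N)) /=.
rewrite (exchange_big_dep xpredT) //=; apply: eq_bigr => j _.
by rewrite -(big_ord_widen n (fun=> 1%N) (ltnW (ltn_ord j))) sum1_card card_ord.
Qed.

Section PairsSum.
Variable n : nat.
Implicit Types F G : 'I_n -> 'I_n -> R.

Lemma pairs_sum_const (c : R) :
  pairs_sum (fun _ _ : 'I_n => c) = Npairs n * c.
Proof. by rewrite /Npairs -card_ordered_pairs -Rsum_const. Qed.

Lemma pairs_sumZ (c : R) F :
  pairs_sum (fun i j => c * F i j) = c * pairs_sum F.
Proof. by rewrite /pairs_sum big_distrr. Qed.

Lemma pairs_sumD F G :
  pairs_sum (fun i j => F i j + G i j) = pairs_sum F + pairs_sum G.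
Proof. by rewrite /pairs_sum big_split. Qed.

Lemma eq_pairs_sum F G :
  (forall i j, i != j -> F i j = G i j) -> pairs_sum F = pairs_sum G.
Proof.
move=> FG; apply: eq_bigr => -[i j] /= ij; apply: FG.
by apply: contraTneq ij => ->; rewrite ltnn.
Qed.

Lemma pairs_sum_double F :
  (forall i j, F i j = F j i) ->
  2 * pairs_sum F =
  \big[Rplus/0]_(p : 'I_n * 'I_n | p.1 != p.2) F p.1 p.2.
Proof.
move=> F_sym; rewrite (bigID (fun p : 'I_n * 'I_n => ltn p.1 p.2)) /=.
rewrite [LHS](_ : _ = pairs_sum F + pairs_sum F); last by ring.
congr (_ + _).
  apply: eq_bigl => -[i j] /=.
  by rewrite ltn_neqAle andbA andbb.
pose swap (p : 'I_n * 'I_n) := (p.2, p.1).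
have swapK : involutive swap by case.
rewrite /pairs_sum (reindex_inj (inv_inj swapK)) /=.
apply: eq_big => [[i j]|[i j] _] /=; last exact: F_sym.
by rewrite -leqNgt ltn_neqAle eq_sym.
Qed.

Lemma pairs_sum_perm (p : {perm 'I_n}) F :
  (forall i j, F i j = F j i) ->
  pairs_sum (fun i j => F (p i) (p j)) = pairs_sum F.
Proof.
move=> F_sym; apply: (Rmult_eq_reg_l 2); last by lra.
rewrite !pairs_sum_double //.
pose pp (ij : 'I_n * 'I_n) := (p ij.1, p ij.2).
have pp_inj : injective pp by move=> [i j] [k l] [/perm_inj -> /perm_inj ->].
rewrite [RHS](reindex_inj pp_inj) /=.
by apply: eq_bigl => ij; rewrite (inj_eq perm_inj).
Qed.

Lemma pairs_sum_CauchySchwarz F G :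
  pairs_sum (fun i j => F i j * G i j) ^ 2 <=
  pairs_sum (fun i j => F i j ^ 2) * pairs_sum (fun i j => G i j ^ 2).
Proof. exact: Rsum_CauchySchwarz. Qed.

End PairsSum.

Lemma Npairs_gt0 n : (1 < n)%N -> 0 < Npairs n.
Proof. by move=> n1; apply/lt_0_INR/ltP; rewrite bin_gt0. Qed.

Lemma Npairs_ge0 n : 0 <= Npairs n.
Proof. exact: pos_INR. Qed.

(* At [x = 0] the left-hand side is [0], so [cnorm] may vanish below. *)
Lemma mul_sqr_inv_sqrt_le1 x : 0 <= x -> x * (/ sqrt x) ^ 2 <= 1.
Proof.
move=> x_ge0; case: (Rle_lt_or_eq_dec _ _ x_ge0) => [x_gt0 | <-]; last by lra.
have sqrt_gt0 := sqrt_lt_R0 x x_gt0.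
by rewrite -[X in X * _](sqrt_sqrt x x_ge0); right; field; lra.
Qed.

Section UnitVector.
Variable n : nat.
Implicit Types A B P : {set {set 'I_n}}.

Lemma pairs_sum_centered P : (1 < n)%N -> pairs_sum (centered P) = 0.
Proof.
move=> /Npairs_gt0 N_gt0; rewrite /centered /Rminus pairs_sumD pairs_sum_const.
by rewrite -/(mA P); field; lra.
Qed.

Lemma pairs_sum_uvec A : (1 < #|A| < n)%N -> pairs_sum (uvec A) = 0.
Proof.
move=> /andP [A_gt1 A_ltn].
transitivity (pairs_sum (fun i j => / cnorm A * centered A i j)).
  apply: eq_pairs_sum => i j _.
  by rewrite /uvec (gtn_eqF A_gt1) (ltn_eqF A_ltn) /Rdiv Rmult_comm.
by rewrite pairs_sumZ pairs_sum_centered ?Rmult_0_r // (ltn_trans A_gt1).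
Qed.

Lemma pairs_sum_uvec_sqr_le1 A : pairs_sum (fun i j => uvec A i j ^ 2) <= 1.
Proof.
have N_norm := mul_sqr_inv_sqrt_le1 (Npairs_ge0 n).
rewrite /uvec; case: eqP => _; first by rewrite pairs_sum_const.
case: eqP => _; first by rewrite pairs_sum_const -Rsqr_pow2 -Rsqr_neg Rsqr_pow2.
have -> : pairs_sum (fun i j => (centered A i j / cnorm A) ^ 2) =
    (/ cnorm A) ^ 2 * pairs_sum (fun i j => centered A i j ^ 2).
  rewrite -pairs_sumZ; apply: eq_pairs_sum => i j _.
  by rewrite /Rdiv Rpow_mult_distr Rmult_comm.
by rewrite Rmult_comm; apply/mul_sqr_inv_sqrt_le1/Rsum_sqr_ge0.
Qed.

Lemma CC_bound A B : -1 <= CC A B <= 1.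
Proof.
have := pairs_sum_CauchySchwarz (uvec A) (uvec B); rewrite -/(CC A B).
have := pairs_sum_uvec_sqr_le1 A; have := pairs_sum_uvec_sqr_le1 B.
have norm_ge0 P : 0 <= pairs_sum (fun i j => uvec P i j ^ 2).
  exact: Rsum_sqr_ge0.
by have := norm_ge0 A; have := norm_ge0 B; split; nra.
Qed.

Lemma indic_sym P i j : indic P i j = indic P j i.
Proof.
rewrite /indic; congr (if _ then _ else _).
by apply: eq_existsb => B; rewrite (andbC (i \in B)).
Qed.

Lemma centered_sym P i j : centered P i j = centered P j i.
Proof. by rewrite /centered indic_sym. Qed.

End UnitVector.

(** * Relabelling the points *)

Lemma perm_enum_imset (T T' : finType) (f : T -> T') (A : {set T}) :
  injective f -> perm_eq (enum (f @: A)) (map f (enum A)).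
Proof.
move=> f_inj; apply: uniq_perm; rewrite ?map_inj_uniq ?enum_uniq // => y.
rewrite mem_enum; apply/imsetP/mapP => -[x xA ->]; exists x => //.
  by rewrite mem_enum.
by rewrite -mem_enum.
Qed.

Lemma exists_perm_pair (T : finType) (i j k l : T) : i != j -> k != l ->
  exists p : {perm T}, p i = k /\ p j = l.
Proof.
move=> ij kl; pose t := tperm i k; have ti : t i = k by rewrite tpermL.
exists (t * tperm (t j) l)%g; rewrite !permM ti tpermL; split=> //.
by rewrite tpermD // 1?eq_sym // -ti (inj_eq perm_inj).
Qed.

Definition relabel (T : finType) (p : {perm T}) (P : {set {set T}}) :
  {set {set T}} := [set p @: (B : {set T}) | B in P].

Lemma relabel_inj (T : finType) (p : {perm T}) : injective (relabel p).
Proof. exact/imset_inj/imset_inj/perm_inj. Qed.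

Section Relabel.
Variables (n : nat) (p : {perm 'I_n}).
Implicit Types P : {set {set 'I_n}}.

Lemma card_relabel P : #|relabel p P| = #|P|.
Proof. exact/card_imset/imset_inj/perm_inj. Qed.

Lemma perm_sizes_relabel P : perm_eq (sizes (relabel p P)) (sizes P).
Proof.
have imset_p_inj := imset_inj (@perm_inj _ p).
apply: (perm_trans (perm_map _ (perm_enum_imset P imset_p_inj))).
rewrite -map_comp (eq_map (_ : _ =1 fun B : {set 'I_n} => #|B|)) // => B /=.
exact/card_imset/perm_inj.
Qed.

Lemma relabel_clusterings_with s P :
  (relabel p P \in clusterings_with n s) = (P \in clusterings_with n s).
Proof.
have imset_pT : p @: [set: 'I_n] = [set: 'I_n].
  by apply/im_perm_on/subsetP => i; rewrite inE.
rewrite !inE (permPl (perm_sizes_relabel P)) /clustering -{1}imset_pT.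
by rewrite imset_partition //; apply: perm_inj.
Qed.

Lemma indic_relabel P i j : indic (relabel p P) (p i) (p j) = indic P i j.
Proof.
have p_inj := @perm_inj _ p; rewrite /indic; congr (if _ then _ else _).
apply/existsP/existsP.
  move=> [_ /andP [/imsetP [B BP ->]]]; rewrite !mem_imset // => ijB.
  by exists B; rewrite BP.
by move=> [B /andP [BP ijB]]; exists (p @: B); rewrite imset_f // !mem_imset.
Qed.

Lemma mA_relabel P : mA (relabel p P) = mA P.
Proof.
rewrite /mA -(pairs_sum_perm p) //; last exact: indic_sym.
by apply: eq_pairs_sum => i j _; rewrite indic_relabel.
Qed.

Lemma centered_relabel P i j :
  centered (relabel p P) (p i) (p j) = centered P i j.
Proof. by rewrite /centered mA_relabel indic_relabel. Qed.

Lemma cnorm_relabel P : cnorm (relabel p P) = cnorm P.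
Proof.
rewrite /cnorm -[in LHS](pairs_sum_perm p); last first.
  by move=> i j; rewrite centered_sym.
by congr sqrt; apply: eq_pairs_sum => i j _; rewrite centered_relabel.
Qed.

Lemma uvec_relabel P i j : uvec (relabel p P) (p i) (p j) = uvec P i j.
Proof. by rewrite /uvec card_relabel centered_relabel cnorm_relabel. Qed.

End Relabel.

(** * Clusterings with prescribed sizes *)

Lemma perm_enum_setU1 (T : finType) (x : T) (A : {set T}) :
  x \notin A -> perm_eq (enum (x |: A)) (x :: enum A).
Proof.
move=> xA; rewrite (perm_trans (enum_setU _ _)) // enum_set1 undup_id //.
by rewrite /= mem_enum xA enum_uniq.
Qed.

Lemma partition_of_sizes (T : finType) (D : {set T}) (s : seq nat) :
  all (fun x => ltn 0%nat x) s -> sumn s = #|D| ->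
  exists2 P : {set {set T}},
    partition P D & perm_eq [seq #|B : {set T}| | B <- enum P] s.
Proof.
elim: s D => [|x s IH] D /=.
  move=> _ /esym/eqP; rewrite cards_eq0 => /eqP ->.
  by exists set0; rewrite ?partition_set0 ?enum_set0.
move=> /andP [x_gt0 s_gt0] sumD.
have /card_gt0P [C] : (0 < #|[set C : {set T} | C \subset D & #|C| == x]|)%N.
  by rewrite cards_draws bin_gt0 -sumD leq_addr.
rewrite inE => /andP [CD /eqP cardC].
have [P PD Ps] : exists2 P : {set {set T}}, partition P (D :\: C) &
    perm_eq [seq #|B : {set T}| | B <- enum P] s.
  by apply: IH => //; rewrite cardsDS // cardC -sumD addKn.
have C_neq0 : C != set0 by rewrite -cards_eq0 cardC -lt0n.
have C_disj : [disjoint C & D :\: C].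
  by rewrite -setI_eq0 setIC setIDAC -setIDA setDv setI0.
have CP : C \notin P.
  have /set0Pn [y yC] := C_neq0.
  by apply/negP => /(partitionS PD)/subsetP/(_ y yC); rewrite in_setD yC.
exists (C |: P).
  by rewrite -(setID D C) (setIidPr CD); apply: partitionU1.
apply: (perm_trans (perm_map _ (perm_enum_setU1 CP))).
by rewrite /= cardC perm_cons.
Qed.

Lemma card_clusterings_with_gt0 n s :
  size_spec n s -> (0 < #|clusterings_with n s|)%N.
Proof.
move=> [s_gt0 sum_s].
have [|P PT Ps] := @partition_of_sizes _ [set: 'I_n] _ s_gt0.
  by rewrite cardsT card_ord.
by apply/card_gt0P; exists P; rewrite inE; apply/andP.
Qed.

Section Expectation.
Variables (n : nat) (s : seq nat).
Local Notation E := (Expect_C n s).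
Implicit Types (A : {set {set 'I_n}}) (f g : {set {set 'I_n}} -> R).

Lemma eq_Expect_C f g : (forall B, f B = g B) -> E f = E g.
Proof. by move=> fg; rewrite /Expect_C (eq_bigr g). Qed.

Lemma Expect_C_const (c : R) : size_spec n s -> E (fun=> c) = c.
Proof.
move=> /card_clusterings_with_gt0/ltP/lt_0_INR K_gt0.
by rewrite /Expect_C Rsum_const; field; lra.
Qed.

Lemma Expect_C_scal (c : R) f : E (fun B => c * f B) = c * E f.
Proof. by rewrite /Expect_C -big_distrr /= /Rdiv Rmult_assoc. Qed.

Lemma Expect_C_add f g : E (fun B => f B + g B) = E f + E g.
Proof. by rewrite /Expect_C big_split /= /Rdiv Rmult_plus_distr_r. Qed.

Lemma Expect_C_pairs_sum (F : {set {set 'I_n}} -> 'I_n -> 'I_n -> R) :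
  E (fun B => pairs_sum (F B)) = pairs_sum (fun i j => E (fun B => F B i j)).
Proof. by rewrite /Expect_C /pairs_sum exchange_big -big_distrl. Qed.

Lemma Expect_C_relabel (p : {perm 'I_n}) f : E (fun B => f (relabel p B)) = E f.
Proof.
rewrite /Expect_C [in RHS](reindex_inj (@relabel_inj _ p)) /=.
by congr (_ / _); apply: eq_bigl => B; rewrite relabel_clusterings_with.
Qed.

Lemma is_series_Expect_C (u : {set {set 'I_n}} -> nat -> R) f :
  (forall B, is_series (u B) (f B)) -> is_series (fun k => E (u^~ k)) (E f).
Proof.
move=> uf; apply: (is_series_scal_r (/ INR #|clusterings_with n s|)).
by apply: is_series_Rsum => B _; apply: uf.
Qed.

Lemma Expect_C_uvec_const :
  exists c, forall i j, i != j -> E (fun B => uvec B i j) = c.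
Proof.
case: (pickP (fun p : 'I_n * 'I_n => p.1 != p.2)) => [[k l] kl | no_pair].
  exists (E (fun B => uvec B k l)) => i j ij.
  have [p [pi pj]] := exists_perm_pair ij kl.
  rewrite -(Expect_C_relabel p (fun B => uvec B k l)); apply: eq_Expect_C => B.
  by rewrite -[k]pi -[l]pj uvec_relabel.
by exists 0 => i j ij; have := no_pair (i, j); rewrite /= ij.
Qed.

Lemma Expect_C_CC A : (1 < #|A| < n)%N -> E (CC A) = 0.
Proof.
move=> A_nontrivial; have [c uvec_c] := Expect_C_uvec_const.
rewrite /CC Expect_C_pairs_sum.
transitivity (pairs_sum (fun i j => c * uvec A i j)).
  by apply: eq_pairs_sum => i j ij; rewrite Expect_C_scal uvec_c // Rmult_comm.
by rewrite pairs_sumZ pairs_sum_uvec // Rmult_0_r.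
Qed.

Lemma is_series_Expect_C_asin_CC A :
  is_series (fun k => asin_coef k * E (fun B => CC A B ^ (2 * k + 1)%N))
            (E (fun B => asin (CC A B))).
Proof.
apply: is_series_ext (is_series_Expect_C
  (fun B => is_series_asin (CC_bound A B))) => k.
exact: Expect_C_scal.
Qed.

Lemma Expect_C_CD A : size_spec n s ->
  E (CD A) = 1 / 2 - 1 / PI * E (fun B => asin (CC A B)).
Proof.
move=> sn; rewrite -[1 / 2](Expect_C_const _ sn) /Rminus Ropp_mult_distr_l.
rewrite -Expect_C_scal -Expect_C_add; apply: eq_Expect_C => B.
by rewrite /CD (acos_asin _ (CC_bound A B)); field; apply: PI_neq0.
Qed.

End Expectation.

Theorem mainTheorem7 (n : nat) (A : {set {set 'I_n}}) (s : seq nat) :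
  clustering A -> ltn 1%nat #|A| && ltn #|A| n -> size_spec n s ->
  exists l : R,
    infinite_sum
      (fun k : nat =>
         acoef (k + 1)%nat *
         Expect_C n s (fun B => CC A B ^ (2 * (k + 1) + 1)%nat) /
         INR (2 * (k + 1) + 1)%nat) l /\
    Expect_C n s (fun B => CD A B) - 1 / 2 = - (1 / PI) * l.
Proof.
move=> _ A_nontrivial sn; exists (Expect_C n s (fun B => asin (CC A B))).
split; last by rewrite Expect_C_CD //; ring.
pose term k := asin_coef k * Expect_C n s (fun B => CC A B ^ (2 * k + 1)%N).
have term0 : term 0%N = 0.
  rewrite /term (eq_Expect_C _ (g := CC A)) => [|B]; last exact: pow_1.
  by rewrite Expect_C_CC // Rmult_0_r.
apply/is_series_Reals; apply: (is_series_ext (fun k => term k.+1)) => [k|].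
  by rewrite /term asin_coef_mul [(k + 1)%N]addn1.
apply: (is_series_incr_1 term); rewrite term0 plus_zero_r.
exact: is_series_Expect_C_asin_CC.
Qed.
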